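(* Let $(U_n)_{n\ge 0}$ be the negative but linearly reinforced urn scheme with $k$ colours, parameter $\theta\ge 1$, stochastic replacement matrix $R$ and initial configuration $U_0$, and suppose that $\hat R=\frac{1}{k\theta-1}(\theta J_k-R)$ is irreducible. Then the almost sure limit of the random configuration $\frac{U_n}{n+1}$ as $n\to\infty$ is the uniform distribution $(1/k,\dots,1/k)$ on the set of colours if and only if $R$ is doubly stochastic, that is, $\mathbf 1R=\mathbf 1$.
   Context: Model. Let $k\ge 2$ be an integer, $S=\{0,1,\dots,k-1\}$ the set of colours, $\theta\ge 1$ a real parameter, $R=((R_{i,j}))_{0\le i,j\le k-1}$ a stochastic matrix (nonnegative entries, all row sums equal to $1$), and $U_0=(U_{0,j})_{0\le j\le k-1}$ a (deterministic) probability vector on $S$. The negative but linearly reinforced urn scheme with initial configuration $U_0$ and replacement matrix $R$ is the process $(U_n)_{n\ge0}$ of random row vectors in $[0,\infty)^k$ defined recursively as follows. With $\mathcal F_n=\sigma(U_0,\dots,U_n)$, the random colour $Z_n\in S$ (the colour chosen at draw $n+1$) satisfies $$\mathbb P(Z_n=j\mid\mathcal F_n)=\frac{1}{k\theta-1}\left(\theta-\frac{U_{n,j}}{n+1}\right),\quad 0\le j\le k-1,$$ and $U_{n+1}=U_n+\chi_{n+1}R$, where $\chi_{n+1}=(\mathbf 1(Z_n=j))_{0\le j\le k-1}$ is a row vector. (Then $\sum_j U_{n,j}=n+1$ for all $n$.) Notation. $\mathbf 1$ denotes the row vector of length $k$ with all entries $1$, $J_k$ the $k\times k$ matrix with all entries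 $1$. The matrix $\hat R=\frac{1}{k\theta-1}(\theta J_k-R)$ is stochastic, and irreducibility is meant in the Markov chain sense. *)

(* Defs.v *)
From HB Require Import structures.
From mathcomp Require Import all_boot all_order all_algebra.
From mathcomp Require Import all_classical all_reals all_analysis.

Set Implicit Arguments.
Unset Strict Implicit.
Unset Printing Implicit Defensive.

Import Order.TTheory GRing.Theory Num.Theory.
Import numFieldNormedType.Exports.

Local Open Scope classical_set_scope.
Local Open Scope ring_scope.

Definition prob_vector (R : realType) (k : nat) (u : 'rV[R]_k) : Prop :=
  (forall j, 0 <= u 0 j) /\ \sum_j u 0 j = 1.

Definition stochastic (R : realType) (k : nat) (M : 'M[R]_k) : Prop :=
  (forall i j, 0 <= M i j) /\ (forall i, \sum_j M i j = 1).

Definition doubly_stochastic (R : realType) (k : nat) (M : 'M[R]_k) : Prop :=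
  stochastic M /\ (const_mx 1 : 'rV[R]_k) *m M = const_mx 1.

(* Every state can be reached from every state with positive probability.
   Allowing [n = 0] makes no difference as soon as there are two states. *)
Definition irreducible (R : realType) (k : nat) (M : 'M[R]_k) : Prop :=
  forall i j, exists n : nat, 0 < (M ^+ n) i j.

(* (theta J_k - M) / (k theta - 1) *)
Definition hat_mx (R : realType) (k : nat) (theta : R) (M : 'M[R]_k) :
    'M[R]_k :=
  (k%:R * theta - 1)^-1 *: (theta *: const_mx 1 - M).

(* The sigma-algebra generated by the random vectors U_0, ..., U_n, that is,
   by all their coordinates. *)
Definition natural_filtration (R : realType) (T : Type) (k : nat)
    (U : nat -> T -> 'rV[R]_k) (n : nat) : set (set T) :=
  <<s [set A | exists (m : nat) (j : 'I_k) (B : set R),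
         [/\ (m <= n)%N, measurable B & A = (fun x => U m x 0 j) @^-1` B]] >>.

(* [f] is a version of the conditional probability P(E | G). *)
Definition is_cond_prob (R : realType) (d : measure_display)
    (T : measurableType d) (P : probability T R) (G : set (set T))
    (E : set T) (f : T -> R) : Prop :=
  [/\ forall B : set R, measurable B -> G (f @^-1` B),
      P.-integrable setT (EFin \o f) &
      forall A : set T, G A -> (\int[P]_(x in A) (f x)%:E = P (E `&` A))%E].

(* [Z n x] is the colour chosen at draw [n + 1], and [delta_mx 0 (Z n x)] is the
   row vector chi_(n+1). *)
Record urn_scheme (R : realType) (d : measure_display)
    (T : measurableType d) (P : probability T R) (k : nat) (theta : R)
    (M : 'M[R]_k) (U0 : 'rV[R]_k) (U : nat -> T -> 'rV[R]_k)
    (Z : nat -> T -> 'I_k) : Prop := UrnScheme {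
  urn_measurable_colour : forall n j, measurable [set x | Z n x = j];
  urn_init : forall x, U 0%N x = U0;
  urn_step : forall n x, U n.+1 x = U n x + delta_mx 0 (Z n x) *m M;
  urn_draw : forall n j,
    is_cond_prob P (natural_filtration U n) [set x | Z n x = j]
      (fun x => (k%:R * theta - 1)^-1 * (theta - U n x 0 j / n.+1%:R))
}.

(* Main.v *)
Require Import Defs.
From HB Require Import structures.
From mathcomp Require Import all_boot all_order all_algebra.
From mathcomp Require Import all_classical all_reals all_analysis.
From mathcomp Require Import measurable_realfun ring lra.

Set Implicit Arguments.
Unset Strict Implicit.
Unset Printing Implicit Defensive.

Import Order.TTheory GRing.Theory Num.Theory.
Import numFieldNormedType.Exports.

Local Open Scope classical_set_scope.
Local Open Scope ring_scope.

(** Write [a] for the proportions [U n / n.+1], [b] for their deviation from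
    uniformity and [c = (k theta - 1)^-1].

    If the limit is uniform, so is the limit of the draw probabilities
    [c (theta - a i)].  The expected increment of [U n] then tends to
    [k^-1 1 M] and, by Cesaro's theorem, so does the expectation of [a]; since
    this expectation tends to [k^-1 1] by dominated convergence, [1 M = 1]
    ([uniform_limit_doubly_stochastic]).

    Conversely, let [M] be doubly stochastic, and consider [V n = |b|^2].  The
    conditional mean of the increment of [a] is [- (b + c b M) / n.+2], and
    irreducibility provides [g > 0] with [|b|^2 + c <b, b M> >= g |b|^2]
    ([irreducible_drift_gap]).  Hence
    [E (V n.+1) <= (1 - 2 g / n.+2) E (V n) + k / n.+2 ^ 2]
    ([expected_sq_dist_drift]), and summation shows that the series of the
    [E (V n) / n.+2] converges, so that the series of the [V n / n.+2] converges
    almost surely.  As [V n] changes by [O (1 / n)] at each draw, this forces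
    [V n] to tend to [0] ([slowly_varying_cvg0], [sq_dist_cvg0]).

    Expectations are computed by viewing [U] as a Markov chain with finitely many
    possible values at each time ([urn_expectation_step]). *)

(** * The restoring force of the averaged dynamics *)

(** When [M] is doubly stochastic, the deviation [b] of the proportions from
    uniformity moves on average in the direction [- (b + c *: (b *m M))], with
    [c = (k%:R * theta - 1)^-1].  The inequality says that the component of
    this direction along [b] pulls back towards [0], at rate at least [g]. *)
Definition drift_gap (R : realType) (k : nat) (theta : R) (M : 'M[R]_k)
    (g : R) : Prop :=
  forall b : 'I_k -> R,
    g * \sum_j b j ^+ 2 <=
    \sum_j b j ^+ 2 +
    (k%:R * theta - 1)^-1 * \sum_i \sum_j b i * M i j * b j.

(** For doubly stochastic [M], the sum of the [M i j * (b i + b j) ^+ 2] equals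
    twice [|b|^2 + <b, b M>], so that [<b, b M> >= - |b|^2].  This gives the gap
    [1 - c] when [c < 1].  Otherwise [c = 1], hence [k = 2] and [theta = 1], and
    [M] has the single free parameter [M 0 0]; here the gap is [2 * M 0 0], and
    irreducibility excludes [M 0 0 = 0], for which [hat_mx theta M] is the
    identity. *)
Lemma irreducible_drift_gap (R : realType) (k : nat) (theta : R) (M : 'M[R]_k) :
  (2 <= k)%N -> 1 <= theta -> doubly_stochastic M ->
  irreducible (hat_mx theta M) ->
  exists2 g : R, 0 < g & drift_gap theta M g.
Proof.
move=> k2 th1 [[M0 Mrow] Mcol1] irr.
have Mcol j : \sum_i M i j = 1.
  move/rowP: Mcol1 => /(_ j); rewrite !mxE => <-.
  by apply: eq_bigr => i _; rewrite mxE mul1r.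
have kth : 2 <= k%:R * theta.
  by rewrite -[2]mulr1 ler_pM ?ler_nat.
have energy (b : 'I_k -> R) : \sum_i \sum_j M i j * (b i + b j) ^+ 2 =
    2 * (\sum_j b j ^+ 2 + \sum_i \sum_j b i * M i j * b j).
  have s1 : \sum_i \sum_j M i j * b i ^+ 2 = \sum_j b j ^+ 2.
    by apply: eq_bigr => i _; rewrite -mulr_suml Mrow mul1r.
  have s2 : \sum_i \sum_j M i j * b j ^+ 2 = \sum_j b j ^+ 2.
    by rewrite exchange_big; apply: eq_bigr => i _; rewrite -mulr_suml Mcol mul1r.
  rewrite mulrDr mulr_natl mulr2n -{1}s1 -s2 mulr_sumr -!big_split.
  apply: eq_bigr => i _; rewrite mulr_sumr -!big_split.
  by apply: eq_bigr => j _ /=; ring.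
have energy_ge0 (b : 'I_k -> R) : 0 <= \sum_i \sum_j M i j * (b i + b j) ^+ 2.
  by do 2 (apply: sumr_ge0 => ? _); rewrite mulr_ge0 ?sqr_ge0.
have [c1|c1] := ltP 2 (k%:R * theta).
  exists (1 - (k%:R * theta - 1)^-1).
    by rewrite subr_gt0 invf_lt1; lra.
  move=> b; have := energy_ge0 b; rewrite energy.
  have c0 : 0 <= (k%:R * theta - 1)^-1 by rewrite invr_ge0; lra.
  move=> E0; rewrite -subr_ge0.
  set c := (k%:R * theta - 1)^-1 in c0 *.
  set s := \sum_j b j ^+ 2 in E0 *; set q := \sum_i _ in E0 *.
  have -> : s + c * q - (1 - c) * s = c * (s + q) by ring.
  by rewrite mulr_ge0//; lra.
(* Equality in [2 <= k * theta] forces two colours and [theta = 1]. *)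
have k2E : k = 2%N.
  apply/eqP; rewrite eqn_leq k2 andbT -(ler_nat R).
  by rewrite (le_trans _ c1)// ler_peMr// ler0n.
subst k; rewrite /drift_gap; have -> : 2%:R * theta - 1 = 1 by lra.
have theta1 : theta = 1 by lra.
have M00 : 0 < M 0 0.
  rewrite lt_neqAle M0 andbT; apply/negP => /eqP m0.
  have := Mrow 0; have := Mcol 0; have := Mrow 1.
  rewrite !big_ord_recl !big_ord0 /= !addr0.
  have -> : lift ord0 ord0 = 1 :> 'I_2 by exact/val_inj.
  have -> : ord0 = 0 :> 'I_2 by exact/val_inj.
  move=> r1 c0 r0.
  have hat1 : hat_mx theta M = 1%:M.
    apply/matrixP => i j; rewrite !mxE theta1.
    have E2 (u : 'I_2) : u = 0 \/ u = 1.
      by case: u => [[|[|//]] ?]; [left|right]; exact/val_inj.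
    have -> : (2%:R * 1 - 1)^-1 = 1 :> R by rewrite -[RHS]invr1; congr _^-1; lra.
    case: (E2 i) => ->; case: (E2 j) => ->; rewrite /= ?mulr1n ?mulr0n; lra.
  case: (irr 0 1) => n; rewrite hat1.
  have -> : (1%:M : 'M[R]_2) ^+ n = 1%:M by exact: expr1n.
  by rewrite mxE ltxx.
exists (2 * M 0 0) => [|b]; first by rewrite mulr_gt0.
have := Mrow 0; have := Mcol 0; have := Mrow 1.
rewrite !big_ord_recl !big_ord0 /= !addr0 invr1 mul1r.
have -> : lift ord0 ord0 = 1 :> 'I_2 by exact/val_inj.
have -> : ord0 = 0 :> 'I_2 by exact/val_inj.
move=> r1 c0 r0.
have -> : M 0 1 = 1 - M 0 0 by lra.
have -> : M 1 1 = M 0 0 by lra.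
have -> : M 1 0 = 1 - M 0 0 by lra.
have : 0 <= (1 - M 0 0) * (b 0 + b 1) ^+ 2.
  by rewrite mulr_ge0 ?sqr_ge0//; have := M0 0 1; lra.
nra.
Qed.


(** * A Tauberian lemma *)

(** The squares vary by at most [C * u n + 2 * C * u n.+1], where
    [u n = v n / n.+2%:R] is summable; so the squares converge.  A nonzero limit
    would bound [u n] below by a multiple of the harmonic sequence. *)
Lemma slowly_varying_cvg0 (R : realType) (v : R^nat) (C : R) :
  (forall n, 0 <= v n) -> (forall n, v n <= C) ->
  (forall n, `|v n.+1 - v n| <= C / n.+2%:R) ->
  cvgn (series (fun n => v n / n.+2%:R)) ->
  v @ \oo --> 0.
Proof.
move=> v0 vC vvar; set u := fun n => v n / n.+2%:R => usum.
have C0 : 0 <= C by rewrite (le_trans (v0 0%N)).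
have u0 n : 0 <= u n by rewrite /u divr_ge0.
have vu n : v n = u n * n.+2%:R by rewrite /u divfK// pnatr_eq0.
have ub n : \sum_(0 <= i < n) u i <= limn (series u).
  exact: (nondecreasing_cvgn_le (nondecreasing_series (fun n _ _ => u0 n)) usum).
have sqr_var n : `|v n.+1 ^+ 2 - v n ^+ 2| <= C * u n + 2 * C * u n.+1.
  rewrite subr_sqr normrM [X in _ * X]ger0_norm ?addr_ge0//.
  apply: (@le_trans _ _ (C / n.+2%:R * (v n.+1 + v n))).
    by rewrite ler_wpM2r// addr_ge0.
  have h : 0 < n.+2%:R :> R by rewrite ltr0n.
  rewrite mulrDr addrC lerD//; first by rewrite /u mulrAC mulrA.
  rewrite (vu n.+1).
  have -> : C / n.+2%:R * (u n.+1 * n.+3%:R) = n.+3%:R / n.+2%:R * (C * u n.+1).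
    by ring.
  rewrite -[leRHS]mulrA ler_wpM2r ?mulr_ge0// ler_pdivrMr// -natrM ler_nat.
  by rewrite mul2n -addnn -addn1 leq_add2l.
have sqr_cvg : cvgn (fun n => v n ^+ 2).
  have cv : cvgn (series (telescope (fun n => v n ^+ 2))).
    apply: normed_cvg => /=; apply: nondecreasing_is_cvgn.
      by apply: nondecreasing_series => n _ _; exact: normr_ge0.
    exists (C * limn (series u) + 2 * C * limn (series u)) => _ [n _ <-] /=.
    apply: (@le_trans _ _ (\sum_(0 <= i < n) (C * u i + 2 * C * u i.+1))).
      by apply: ler_sum => i _; exact: sqr_var.
    rewrite big_split /= -!mulr_sumr lerD// ler_wpM2l// ?mulr_ge0//.
    by apply: le_trans (ub n.+1); rewrite [leRHS]big_nat_recl// ler_wpDl.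
  have -> : (fun n => v n ^+ 2) =
      (fun n => v 0%N ^+ 2 + series (telescope (fun n => v n ^+ 2)) n).
    by apply/funext => n; rewrite -eq_sum_telescope.
  by apply: is_cvgD => //; exact: is_cvg_cst.
have lim_ge0 : 0 <= limn (fun n => v n ^+ 2).
  by apply: limr_ge => //; apply: nearW => n; exact: sqr_ge0.
have lim0 : limn (fun n => v n ^+ 2) = 0.
  apply/eqP; rewrite eq_le lim_ge0 andbT leNgt; apply/negP => L0.
  apply: (@dvg_harmonic R).
  set L := limn _ in L0.
  have [N _ LN] : \forall n \near \oo, L / 2 < v n ^+ 2.
    by apply: (cvgr_gt L sqr_cvg); lra.
  have Cpos : 0 < C.
    rewrite lt_neqAle C0 andbT; apply/eqP => C0'.
    have := LN N (leqnn N); have := vC N; have := v0 N; rewrite /= -C0'; nra.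
  rewrite -(is_cvg_series_restrict N).
  apply: nondecreasing_is_cvgn.
    apply/nondecreasing_seqP => n; have [Nn|nN] := leqP N n.
      by rewrite /= big_nat_recr// lerDl /= invr_ge0.
    by rewrite /= !big_geq// ltnW.
  exists (4 * C / L * limn (series u)) => _ [n _ <-] /=.
  have [nN|Nn] := leqP n N.
    rewrite big_geq// mulr_ge0// ?divr_ge0// ?mulr_ge0//.
    by have := ub 0%N; rewrite big_geq.
  apply: (@le_trans _ _ (\sum_(N <= i < n) 4 * C / L * u i)).
    apply: ler_sum_nat => i /andP[Ni _].
    have Lv : L / 2 <= C * v i.
      by apply: le_trans (ltW (LN i Ni)) _; rewrite expr2 ler_wpM2r.
    have -> : 4 * C / L * u i = (C * v i) / (L / 2) * (2 / i.+2%:R).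
      have : i.+2%:R != 0 :> R by rewrite pnatr_eq0.
      by rewrite /u; move: i.+2%:R => y y0; field; rewrite y0 gt_eqF.
    apply: (@le_trans _ _ (2 / i.+2%:R)).
      rewrite ler_pdivlMr// mulrC ler_pdivrMr// -natrM ler_nat.
      by rewrite mul2n -addnn -addn1 leq_add2l.
    rewrite ler_peMl// ?divr_ge0// ler_pdivlMr ?mul1r//; lra.
  rewrite -mulr_sumr ler_wpM2l ?divr_ge0 ?mulr_ge0//.
  apply: le_trans (ub n); rewrite [leRHS](big_cat_nat _ _ (n := N))//=.
    by rewrite lerDr sumr_ge0.
  exact: ltnW.
apply/cvgrPdist_lt => e e0.
have : \forall n \near \oo, v n ^+ 2 < e ^+ 2.
  apply: (cvgr_lt 0); last by rewrite exprn_gt0.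
  by rewrite -lim0.
apply: filterS => n; rewrite sub0r normrN ger0_norm//.
by rewrite ltr_pXn2r// ?nnegrE// ltW.
Qed.

(** * The urn as a Markov chain *)

Lemma Rintegral_simple (R : realType) (d : measure_display)
    (T : measurableType d) (P : probability T R) (I : Type) (s : seq I)
    (c : I -> R) (A : I -> set T) :
  (forall i, measurable (A i)) ->
  P.-integrable setT (EFin \o (fun x => \sum_(i <- s) c i * \1_(A i) x)) /\
  \int[P]_x (\sum_(i <- s) c i * \1_(A i) x) = \sum_(i <- s) c i * fine (P (A i)).
Proof.
move=> mA.
have int1 i : P.-integrable setT (fun x => (c i)%:E * (\1_(A i) x)%:E)%E.
  by apply: integrableZl => //; exact: integrable_indic.
have -> : EFin \o (fun x => \sum_(i <- s) c i * \1_(A i) x) =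
    (fun x => \sum_(i <- s) (c i)%:E * (\1_(A i) x)%:E)%E.
  by apply/funext => x /=; rewrite -sumEFin.
split; first exact: integrable_sum.
rewrite /Rintegral; under eq_integral do rewrite -sumEFin.
under eq_integral do under eq_bigr do rewrite EFinM.
rewrite integral_sum// -sum_fine.
  apply: eq_bigr => i _; rewrite integralZl//; last exact: integrable_indic.
  by rewrite integral_indic// setIT fineM// fin_num_measure.
by move=> i _; exact: integrable_fin_num.
Qed.

Section urn.
Variables (R : realType) (d : measure_display) (T : measurableType d).
Variables (P : probability T R) (k : nat) (theta : R) (M : 'M[R]_k).
Variables (U0 : 'rV[R]_k) (U : nat -> T -> 'rV[R]_k) (Z : nat -> T -> 'I_k).
Hypotheses (M_stoch : stochastic M) (U0_prob : prob_vector U0).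
Hypothesis urnU : urn_scheme P theta M U0 U Z.

Definition urn_state n (v : 'rV[R]_k) : Prop :=
  (forall j, 0 <= v 0 j) /\ \sum_j v 0 j = n.+1%:R.

Definition draw_prob n (v : 'rV[R]_k) (i : 'I_k) : R :=
  (k%:R * theta - 1)^-1 * (theta - v 0 i / n.+1%:R).

Lemma urn_stepE n x : U n.+1 x = U n x + row (Z n x) M.
Proof. by rewrite (urn_step urnU) -rowE. Qed.

Lemma urn_state_add n v i : urn_state n v -> urn_state n.+1 (v + row i M).
Proof.
move=> [v0 vsum]; case: M_stoch => M0 Msum; split=> [j|].
  by rewrite !mxE addr_ge0.
under eq_bigr do rewrite !mxE.
by rewrite big_split /= vsum Msum -[RHS]natr1.
Qed.

Lemma urn_stateU n x : urn_state n (U n x).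
Proof.
elim: n => [|n IHn]; first by rewrite (urn_init urnU); case: U0_prob.
by rewrite urn_stepE; exact: urn_state_add.
Qed.

(** The values of [U n] are determined by the first [n] colours.  Finiteness makes
    every function of [U n] simple, hence measurable and integrable, and reduces
    conditioning on the past to conditioning on the events [U n = v]. *)
Lemma urn_finite_range n :
  exists2 s : seq 'rV[R]_k, uniq s & forall x, U n x \in s.
Proof.
elim: n => [|n [s _ sU]].
  by exists [:: U0] => // x; rewrite (urn_init urnU) mem_head.
exists (undup [seq v + row i M | v <- s, i <- enum 'I_k]); first exact: undup_uniq.
move=> x; rewrite mem_undup urn_stepE.
by apply: allpairs_f; rewrite ?mem_enum.
Qed.

(** The scheme asserts measurability of the colours only; that of the
    configurations follows by induction, adding one draw at a time. *)
Lemma measurable_urn_eq n v : measurable [set x | U n x = v].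
Proof.
elim: n v => [|n IHn] v.
  have [U0v|U0v] := eqVneq U0 v.
    rewrite (_ : [set _ | _] = setT)//.
    by apply/seteqP; split=> x //= _; rewrite (urn_init urnU) U0v.
  rewrite (_ : [set _ | _] = set0)//.
  apply/seteqP; split=> x //=; rewrite (urn_init urnU) => /eqP.
  by rewrite (negbTE U0v).
rewrite (_ : [set _ | _] = \bigcup_(i in [set: 'I_k])
    ([set x | Z n x = i] `&` [set x | U n x = v - row i M])).
  apply: fin_bigcup_measurable => // i _; apply: measurableI => //.
  exact: (urn_measurable_colour urnU).
apply/seteqP; split=> x /=; rewrite urn_stepE.
  by move=> <-; exists (Z n x) => //=; rewrite addrK.
by case=> i _ /= [-> ->]; rewrite subrK.
Qed.

Lemma natural_filtration_urn_eq n v : natural_filtration U n [set x | U n x = v].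
Proof.
pose G := [set A | exists (m : nat) (j : 'I_k) (B : set R),
         [/\ (m <= n)%N, measurable B & A = (fun x => U m x 0 j) @^-1` B]].
rewrite (_ : [set _ | _] = \bigcap_(j in [set: 'I_k])
    ((fun x => U n x 0 j) @^-1` [set v 0 j])).
  apply: (@fin_bigcap_measurable _ (g_sigma_algebraType G)) => // j _.
  by apply: sub_sigma_algebra; exists n, j, [set v 0 j].
apply/seteqP; split=> x /=; first by move=> Uv j _ /=; rewrite Uv.
by move=> Uv; apply/rowP => j; exact: Uv.
Qed.

(** The conditional probability of a colour is constant on the event [U n = v],
    which belongs to the past. *)
Lemma urn_draw_at n v i : P [set x | U n x = v /\ Z n x = i] =
  ((draw_prob n v i)%:E * P [set x | U n x = v])%E.
Proof.
have [_ _ /(_ _ (@natural_filtration_urn_eq n v))] := urn_draw urnU n i.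
rewrite setIC => <-.
rewrite -integral_cst; last exact: measurable_urn_eq.
by apply: eq_integral => x /set_mem /= ->.
Qed.

Lemma urn_sum_indic n (s : seq 'rV[R]_k) (h : 'rV[R]_k -> R) x :
  uniq s -> U n x \in s ->
  h (U n x) = \sum_(v <- s) h v * \1_[set y | U n y = v] x.
Proof.
move=> us Us; rewrite (bigD1_seq (U n x))//= indicE mem_set// mulr1.
rewrite big1 ?addr0// => v /eqP vU; rewrite indicE memNset ?mulr0//=.
by move=> Uv; apply: vU.
Qed.

Lemma urn_integrable n (h : 'rV[R]_k -> R) :
  P.-integrable setT (fun x => (h (U n x))%:E).
Proof.
have [s us sU] := urn_finite_range n.
rewrite (_ : (fun x => _) = EFin \o
  (fun x => \sum_(v <- s) h v * \1_[set y | U n y = v] x)); last first.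
  by apply/funext => x /=; rewrite -urn_sum_indic.
exact: (Rintegral_simple P s h (fun v => measurable_urn_eq n v)).1.
Qed.

(** The Markov property: the conditional law of the colour drawn depends on the
    past through the current configuration only. *)
Lemma urn_expectation_step n (g : 'rV[R]_k -> R) :
  \int[P]_x g (U n.+1 x) =
  \int[P]_x \sum_i draw_prob n (U n x) i * g (U n x + row i M).
Proof.
have [s us sU] := urn_finite_range n.
pose A (vi : 'rV[R]_k * 'I_k) := [set x | U n x = vi.1 /\ Z n x = vi.2].
have mA vi : measurable (A vi).
  by apply: measurableI; [exact: measurable_urn_eq|
                          exact: (urn_measurable_colour urnU)].
transitivity (\int[P]_x \sum_(vi <- [seq (v, i) | v <- s, i <- enum 'I_k])
    g (vi.1 + row vi.2 M) * \1_(A vi) x).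
  apply: eq_Rintegral => x _; rewrite (bigD1_seq (U n x, Z n x))/=.
  - rewrite urn_stepE indicE mem_set// mulr1 big1 ?addr0// => -[v i] /eqP viN.
    rewrite indicE memNset ?mulr0// => -[/= Uv Zi]; apply: viN.
    by rewrite Uv Zi.
  - by apply: allpairs_f; rewrite ?mem_enum.
  - by rewrite allpairs_uniq ?enum_uniq// => -[? ?] [].
rewrite (Rintegral_simple P _ _ mA).2.
transitivity (\int[P]_x \sum_(v <- s)
    (\sum_i draw_prob n v i * g (v + row i M)) * \1_[set y | U n y = v] x).
  rewrite (Rintegral_simple P _ _ (fun v => measurable_urn_eq n v)).2.
  rewrite big_allpairs; apply: eq_bigr => v _.
  rewrite mulr_suml big_enum; apply: eq_bigr => i _ /=.
  rewrite /A /= urn_draw_at fineM//; last exact: fin_num_measure (measurable_urn_eq _ _).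
  by rewrite mulrA [g _ * _]mulrC.
apply: eq_Rintegral => x _.
by rewrite -(@urn_sum_indic n s (fun v => \sum_i draw_prob n v i * g (v + row i M))).
Qed.

End urn.

(** * One-step estimates for the distance to uniformity *)

Section drift.
Variables (R : realType) (k : nat) (theta : R) (M : 'M[R]_k).
Hypotheses (k_ge2 : (2 <= k)%N) (theta_ge1 : 1 <= theta).
Hypothesis M_stoch : stochastic M.

Definition sq_dist n (v : 'rV[R]_k) : R :=
  \sum_j (v 0 j / n.+1%:R - k%:R^-1) ^+ 2.

Let k_gt0 : 0 < k%:R :> R. Proof. by rewrite ltr0n ltnW. Qed.

Let ktheta : 2 <= k%:R * theta.
Proof. by rewrite -[2]mulr1 ler_pM ?ler_nat. Qed.

Lemma urn_state_proportion n (v : 'rV[R]_k) j :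
  urn_state n v -> 0 <= v 0 j / n.+1%:R <= 1.
Proof.
move=> [v0 vsum]; rewrite divr_ge0//= ler_pdivrMr// mul1r -vsum.
by rewrite (bigD1 j)//= lerDl sumr_ge0.
Qed.

Lemma draw_prob_ge0 n (v : 'rV[R]_k) i :
  urn_state n v -> 0 <= draw_prob theta n v i.
Proof.
move=> /(urn_state_proportion i)/andP[_ v1].
rewrite mulr_ge0 ?invr_ge0 ?subr_ge0//; last exact: le_trans theta_ge1.
by move: ktheta; lra.
Qed.

Lemma sum_draw_prob n (v : 'rV[R]_k) :
  urn_state n v -> \sum_i draw_prob theta n v i = 1.
Proof.
move=> [_ vsum]; rewrite -mulr_sumr sumrB -mulr_suml vsum divff ?pnatr_eq0//.
rewrite sumr_const card_ord -[theta *+ _]mulr_natl mulVf//.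
by rewrite gt_eqF//; move: ktheta; lra.
Qed.

Lemma sq_dist_ge0 n v : 0 <= sq_dist n v.
Proof. by apply: sumr_ge0 => j _; exact: sqr_ge0. Qed.

Let invk : 0 <= (k%:R^-1 : R) <= 1.
Proof. by rewrite invr_ge0 ltW//= invf_le1// ler1n ltnW. Qed.

Lemma sq_dist_le n v : urn_state n v -> sq_dist n v <= k%:R.
Proof.
move=> vn; apply: (@le_trans _ _ (\sum_(j < k) 1)).
  apply: ler_sum => j _; have := urn_state_proportion j vn; move: invk.
  move: (_^-1) (_ / _) => y a; nra.
by rewrite sumr_const card_ord.
Qed.

Let M_le1 i j : 0 <= M i j <= 1.
Proof.
case: M_stoch => M0 Mrow; rewrite M0/= -(Mrow i) (bigD1 j)//= lerDl.
by apply: sumr_ge0.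
Qed.

Let deviation_step n (v : 'rV[R]_k) i j :
  (v + row i M) 0 j / n.+2%:R - k%:R^-1 =
  (v 0 j / n.+1%:R - k%:R^-1) + (M i j - v 0 j / n.+1%:R) / n.+2%:R.
Proof.
rewrite !mxE -[n.+2%:R]natr1; have : 0 < n.+1%:R :> R by [].
move: n.+1%:R (k%:R) k_gt0 => x y y0 x0; field.
by rewrite !gt_eqF// addr_gt0.
Qed.

Lemma sq_dist_variation n v i : urn_state n v ->
  `|sq_dist n.+1 (v + row i M) - sq_dist n v| <= 2 * k%:R / n.+2%:R.
Proof.
move=> vn; rewrite -sumrB (le_trans (ler_norm_sum _ _ _))//.
apply: (@le_trans _ _ (\sum_(j < k) 2 / n.+2%:R)); last first.
  by rewrite sumr_const card_ord -[leLHS]mulr_natl mulrA [k%:R * _]mulrC.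
apply: ler_sum => j _; rewrite subr_sqr normrM mulrC ler_pM//.
  have vn' : urn_state n.+1 (v + row i M) by exact: urn_state_add.
  have := urn_state_proportion j vn'; have := urn_state_proportion j vn.
  move: invk; set a := v 0 j / _; set b := (v + row i M) 0 j / _; set y := (_^-1).
  by rewrite ler_norml; move=> /andP[? ?] /andP[? ?] /andP[? ?]; apply/andP; split; lra.
rewrite deviation_step addrC addKr normrM [X in _ * X]ger0_norm ?invr_ge0//.
rewrite ler_piMl ?invr_ge0// ler_norml.
move: (M_le1 i j) (urn_state_proportion j vn).
move: (M i j) (v 0 j / n.+1%:R) => y a.
by move=> /andP[? ?] /andP[? ?]; apply/andP; split; lra.
Qed.

(** Drawing colour [i] moves the proportions [a] by [(M i - a) / n.+2].  Expanding
    the square, the linear term has mean [- 2 / n.+2] times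
    [|b|^2 + c <b, b M>], where [b] is the deviation, because the draw
    probabilities are [k^-1 - c * b i] and the columns of [M] sum to [1]; the
    quadratic term is at most [k / n.+2 ^ 2]. *)
Lemma sq_dist_drift (g : R) n v :
  doubly_stochastic M -> drift_gap theta M g ->
  urn_state n v ->
  \sum_i draw_prob theta n v i * sq_dist n.+1 (v + row i M) <=
  (1 - 2 * g / n.+2%:R) * sq_dist n v + k%:R / n.+2%:R ^+ 2.
Proof.
move=> [_ Mcol1] gap vn.
have Mcol j : \sum_i M i j = 1.
  move/rowP: Mcol1 => /(_ j); rewrite !mxE => <-.
  by apply: eq_bigr => i _; rewrite mxE mul1r.
pose a j := v 0 j / n.+1%:R; pose b j := a j - k%:R^-1.
set c := (k%:R * theta - 1)^-1 in gap.
set t : R := n.+2%:R.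
have t0 : 0 < t by rewrite ltr0n.
pose p := draw_prob theta n v.
have pE i : p i = k%:R^-1 - c * b i.
  rewrite /p /draw_prob -/(a i) -/c /b /c; field.
  by rewrite !gt_eqF//; move: ktheta; lra.
have step i : sq_dist n.+1 (v + row i M) <=
    sq_dist n v + k%:R / t ^+ 2 + 2 / t * \sum_j b j * (M i j - a j).
  have -> : k%:R / t ^+ 2 = \sum_(j < k) t^-2.
    by rewrite sumr_const card_ord mulr_natl.
  rewrite mulr_sumr -!big_split; apply: ler_sum => j _ /=.
  rewrite deviation_step -/(a j) -/(b j) -/t sqrrD.
  have -> : (b j * ((M i j - a j) / t)) *+ 2 = 2 / t * (b j * (M i j - a j)).
    by rewrite -mulr_natr; ring.
  rewrite [leLHS]addrAC lerD2r lerD2l expr_div_n ler_piMl ?invr_ge0 ?exprn_ge0 ?(ltW t0)//.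
  move: (M_le1 i j) (urn_state_proportion j vn); rewrite -/(a j).
  move: (M i j) (a j) => y z /andP[? ?] /andP[? ?].
  have : 0 <= (1 - (y - z)) * (1 + (y - z)) by rewrite mulr_ge0//; lra.
  by rewrite expr2; lra.
have mean : \sum_i p i * \sum_j b j * (M i j - a j) =
    - (\sum_j b j ^+ 2 + c * \sum_i \sum_j b i * M i j * b j).
  under eq_bigr do rewrite mulr_sumr.
  rewrite exchange_big [X in c * X]exchange_big mulr_sumr -big_split -sumrN.
  apply: eq_bigr => j _ /=.
  transitivity (b j * (\sum_i p i * M i j - (\sum_i p i) * a j)).
    rewrite mulr_suml -sumrB mulr_sumr; apply: eq_bigr => i _; ring.
  rewrite sum_draw_prob// mul1r.
  have -> : \sum_i p i * M i j =
      k%:R^-1 * \sum_i M i j - c * \sum_i b i * M i j.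
    rewrite !mulr_sumr -sumrB.
    by apply: eq_bigr => i _; rewrite pE; ring.
  rewrite Mcol mulr1.
  by rewrite -mulr_suml /b; ring.
apply: (@le_trans _ _ (\sum_i p i *
    (sq_dist n v + k%:R / t ^+ 2 + 2 / t * \sum_j b j * (M i j - a j)))).
  by apply: ler_sum => i _; rewrite ler_wpM2l// draw_prob_ge0.
under eq_bigr do rewrite mulrDr.
rewrite big_split /= -mulr_suml sum_draw_prob// mul1r.
under eq_bigr do rewrite mulrCA.
rewrite -mulr_sumr mean.
have := gap b; rewrite -/(sq_dist n v).
set q := c * _ => gapb.
have : 2 / t * (g * sq_dist n v) <= 2 / t * (sq_dist n v + q).
  by rewrite ler_wpM2l// divr_ge0// ltW.
have -> : 2 * g / t = 2 / t * g by ring.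
move: (2 / t) (k%:R / t ^+ 2) (sq_dist n v) => r w s; lra.
Qed.

End drift.

(** * Almost sure convergence to uniformity *)

Section expected_distance.
Variables (R : realType) (d : measure_display) (T : measurableType d).
Variables (P : probability T R) (k : nat) (theta : R) (M : 'M[R]_k).
Variables (U0 : 'rV[R]_k) (U : nat -> T -> 'rV[R]_k) (Z : nat -> T -> 'I_k).
Hypotheses (k_ge2 : (2 <= k)%N) (theta_ge1 : 1 <= theta).
Hypotheses (M_stoch : stochastic M) (U0_prob : prob_vector U0).
Hypothesis urnU : urn_scheme P theta M U0 U Z.

Lemma expected_sq_dist_drift (g : R) n :
  doubly_stochastic M -> drift_gap theta M g ->
  \int[P]_x sq_dist n.+1 (U n.+1 x) <=
  (1 - 2 * g / n.+2%:R) * \int[P]_x sq_dist n (U n x) + k%:R / n.+2%:R ^+ 2.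
Proof.
move=> Mds gap.
rewrite (urn_expectation_step urnU).
have int n' (h : 'rV[R]_k -> R) := urn_integrable urnU n' h.
apply: (@le_trans _ _ (\int[P]_x ((1 - 2 * g / n.+2%:R) * sq_dist n (U n x) +
                                   k%:R / n.+2%:R ^+ 2))).
  apply: le_Rintegral => //.
  - exact: (int n (fun v => \sum_i draw_prob theta n v i * sq_dist n.+1 (v + row i M))).
  - exact: (int n (fun v => (1 - 2 * g / n.+2%:R) * sq_dist n v + k%:R / n.+2%:R ^+ 2)).
  - move=> x _; apply: sq_dist_drift => //; exact: (urn_stateU M_stoch U0_prob urnU).
rewrite RintegralD//.
- rewrite RintegralZl//; last exact: (int n (sq_dist n)).
  by rewrite Rintegral_cst// [fine _](congr1 fine (probability_setT P)) mulr1.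
- exact: (int n (fun v => (1 - 2 * g / n.+2%:R) * sq_dist n v)).
- exact: (int n (fun=> k%:R / n.+2%:R ^+ 2)).
Qed.

(** Summing the drift inequality: the decrements of the expectation telescope, and
    [1 / n.+2 ^ 2 <= 1 / n.+1 - 1 / n.+2] makes the error terms telescope too. *)
Lemma expected_sq_dist_summable (g : R) N :
  doubly_stochastic M -> drift_gap theta M g ->
  2 * g * \sum_(0 <= n < N) \int[P]_x sq_dist n (U n x) / n.+2%:R <=
  \int[P]_x sq_dist 0 (U 0 x) + k%:R.
Proof.
move=> Mds gap; pose e n := \int[P]_x sq_dist n (U n x).
(* The induction carries the telescoped remainders on both sides. *)
suff : 2 * g * \sum_(0 <= n < N) e n / n.+2%:R + e N <=
    e 0%N + k%:R * (1 - N.+1%:R^-1).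
  move=> bound; apply: le_trans (le_trans _ bound) _.
    by rewrite lerDl; apply: Rintegral_ge0 => x _; exact: sq_dist_ge0.
  by rewrite lerD2l ler_piMr// gerBl invr_ge0.
elim: N => [|N IH]; first by rewrite big_geq// mulr0 add0r invr1 subrr mulr0 addr0.
have step := expected_sq_dist_drift N Mds gap; rewrite -/(e N) -/(e N.+1) in step.
rewrite big_nat_recr//=.
have le_tele : k%:R / N.+2%:R ^+ 2 <= k%:R * (N.+1%:R^-1 - N.+2%:R^-1) :> R.
  rewrite ler_wpM2l//.
  have -> : N.+1%:R^-1 - N.+2%:R^-1 = (N.+1%:R * N.+2%:R)^-1 :> R.
    rewrite -[N.+2%:R]natr1; have : 0 < N.+1%:R :> R by [].
    by move: N.+1%:R => x x0; field; rewrite !gt_eqF// addr_gt0.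
  by rewrite lef_pV2 ?posrE ?mulr_gt0 ?exprn_gt0// expr2 ler_wpM2r// ler_nat.
have -> : 2 * g * (\sum_(0 <= i < N) e i / i.+2%:R + e N / N.+2%:R) =
  2 * g * \sum_(0 <= i < N) e i / i.+2%:R + 2 * g / N.+2%:R * e N by ring.
move: IH step le_tele; move: (2 * g / N.+2%:R) (2 * g * \sum_(_ <= _ < _) _).
move: (k%:R / N.+2%:R ^+ 2) (N.+1%:R^-1) (N.+2%:R^-1) (e N.+1) (e N) (e 0%N).
move=> z w1 w2 e2 e1 e0 q S; lra.
Qed.

(** By monotone convergence the random series with terms [sq_dist n (U n) / n.+2]
    has finite expectation, so it converges almost surely; every trajectory of
    the distance varies slowly, and the Tauberian lemma applies to it. *)
Lemma sq_dist_cvg0 (g : R) :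
  0 < g -> doubly_stochastic M -> drift_gap theta M g ->
  {ae P, forall x, (fun n => sq_dist n (U n x)) @ \oo --> 0}.
Proof.
move=> g0 Mds gap.
pose f n x := (sq_dist n (U n x) / n.+2%:R)%:E.
have f0 n x : (0 <= f n x)%E by rewrite lee_fin divr_ge0// sq_dist_ge0.
have fint n : P.-integrable setT (f n).
  exact: (urn_integrable urnU n (fun v => sq_dist n v / n.+2%:R)).
have fmeas n : measurable_fun setT (f n) by exact: measurable_int (fint n).
have Fint : P.-integrable setT (fun x => \sum_(n <oo) f n x)%E.
  apply/integrableP; split.
    by apply: ge0_emeasurable_sum.
  under eq_integral do rewrite gee0_abs ?nneseries_ge0//.
  rewrite integral_nneseries//.
  apply: (@le_lt_trans _ _
    ((\int[P]_x sq_dist 0 (U 0 x) + k%:R) / (2 * g))%:E); last exact: ltry.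
  apply: lime_le; first by apply: is_cvg_nneseries => n _ _; exact: integral_ge0.
  apply: nearW => N.
  have -> : (\sum_(0 <= n < N) \int[P]_x f n x =
      (\sum_(0 <= n < N) \int[P]_x sq_dist n (U n x) / n.+2%:R)%:E)%E.
    rewrite -sumEFin; apply: eq_bigr => n _.
    rewrite -RintegralZr//; last exact: (urn_integrable urnU n (sq_dist n)).
    by rewrite /Rintegral fineK//; exact: (integrable_fin_num measurableT (fint n)).
  rewrite lee_fin ler_pdivlMr ?mulr_gt0// mulrC.
  exact: expected_sq_dist_summable.
have := integrable_ae measurableT Fint; apply: filterS => x /(_ I) Ffin.
apply: (@slowly_varying_cvg0 _ _ (2 * k%:R)).
- by move=> n; exact: sq_dist_ge0.
- move=> n; apply: le_trans (sq_dist_le k_ge2 _) _.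
    exact: (urn_stateU M_stoch U0_prob urnU).
  by rewrite ler_peMl// ler1n.
- move=> n; rewrite (urn_stepE urnU); apply: sq_dist_variation => //.
  exact: (urn_stateU M_stoch U0_prob urnU).
- apply: nondecreasing_is_cvgn.
    by apply: nondecreasing_series => n _ _; rewrite divr_ge0// sq_dist_ge0.
  exists (fine (\sum_(n <oo) f n x)%E) => _ [N _ <-].
  rewrite -lee_fin fineK// /series /= -sumEFin.
  by apply: nneseries_lim_ge => i _ _; exact: f0.
Qed.

End expected_distance.

(** * Both implications *)

Section uniform_limit.
Variables (R : realType) (d : measure_display) (T : measurableType d).
Variables (P : probability T R) (k : nat) (theta : R) (M : 'M[R]_k).
Variables (U0 : 'rV[R]_k) (U : nat -> T -> 'rV[R]_k) (Z : nat -> T -> 'I_k).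
Hypotheses (k_ge2 : (2 <= k)%N) (theta_ge1 : 1 <= theta).
Hypotheses (M_stoch : stochastic M) (U0_prob : prob_vector U0).
Hypothesis urnU : urn_scheme P theta M U0 U Z.

Lemma cvg_urn_expectation (h : nat -> 'rV[R]_k -> R) (C l : R) :
  (forall n v, urn_state n v -> `|h n v| <= C) ->
  {ae P, forall x, h n (U n x) @[n --> \oo] --> l} ->
  \int[P]_x h n (U n x) @[n --> \oo] --> l.
Proof.
move=> hC hl.
have mh n : measurable_fun setT (fun x => (h n (U n x))%:E).
  exact: measurable_int (urn_integrable urnU n (h n)).
have intC (c : R) : P.-integrable setT (cst c%:E).
  exact: (urn_integrable urnU 0 (fun=> c)).
have cvE : {ae P, forall x, setT x ->
    (h n (U n x))%:E @[n --> \oo] --> (cst l%:E : T -> \bar R) x}.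
  by apply: filterS hl => x hx _; apply: cvg_EFin => //; exact: nearW.
have bound : {ae P, forall x n, setT x ->
    (`|(h n (U n x))%:E| <= (cst C%:E : T -> \bar R) x)%E}.
  by apply: aeW => x n _; rewrite lee_fin hC//; exact: (urn_stateU M_stoch U0_prob urnU).
have [_ _] := dominated_convergence measurableT mh (measurable_cst _) cvE (intC C) bound.
rewrite integral_cst// [X in (_ * X)%E](probability_setT P) mule1.
exact: fine_cvg.
Qed.

(** If the proportions tend to
    uniformity, so do the draw probabilities, hence the expected increments of
    [U n x 0 j] tend to [\sum_i k^-1 * M i j]; by Cesaro's theorem this is also
    the limit of the expected proportion of colour [j], namely [k^-1]. *)
Lemma uniform_limit_doubly_stochastic :
  {ae P, forall x, (fun n : nat => n.+1%:R^-1 *: U n x) @ \oo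
       --> (const_mx k%:R^-1 : 'rV[R]_k)} ->
  doubly_stochastic M.
Proof.
move=> cvU; split=> //; apply/rowP => j; rewrite !mxE.
under eq_bigr do rewrite mxE mul1r.
have k_neq0 : k%:R != 0 :> R by rewrite pnatr_eq0 -lt0n ltnW.
have ktheta : 2 <= k%:R * theta by rewrite -[2]mulr1 ler_pM ?ler_nat.
have cv_coord : {ae P, forall x i, U n x 0 i / n.+1%:R @[n --> \oo] --> (k%:R^-1 : R)}.
  apply: filterS cvU => x cvx i.
  have := cvg_comp _ _ cvx (@coord_continuous R 1 k 0 i _).
  rewrite mxE; apply: cvg_trans; apply: near_eq_cvg; apply: nearW => n /=.
  by rewrite mxE mulrC.
pose a n := \int[P]_x (U n x 0 j / n.+1%:R).
have cv_a : a n @[n --> \oo] --> (k%:R^-1 : R).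
  apply: (cvg_urn_expectation (h := fun n v => v 0 j / n.+1%:R) (C := 1)).
    by move=> n v vn; have /andP[v0 v1] := urn_state_proportion j vn; rewrite ger0_norm.
  by apply: filterS cv_coord => x.
pose incr n (v : 'rV[R]_k) := \sum_i draw_prob theta n v i * M i j.
have cv_incr : \int[P]_x incr n (U n x) @[n --> \oo] -->
    (\sum_i k%:R^-1 * M i j : R).
  apply: (cvg_urn_expectation (C := 1)) => [n v vn|].
    have p0 i := draw_prob_ge0 k_ge2 theta_ge1 i vn.
    have [M0 Mrow] := M_stoch.
    rewrite ger0_norm; last by apply: sumr_ge0 => i _; rewrite mulr_ge0.
    rewrite -(sum_draw_prob k_ge2 theta_ge1 vn); apply: ler_sum => i _.
    rewrite ler_piMr// -(Mrow i) (bigD1 j)//= lerDl.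
    by apply: sumr_ge0.
  apply: filterS cv_coord => x cvx.
  apply: cvg_big => [|i _]; first exact: add_continuous.
  apply: cvgMr_tmp.
  have -> : k%:R^-1 = (k%:R * theta - 1)^-1 * (theta - k%:R^-1) :> R.
    have : k%:R * theta - 1 != 0 by rewrite gt_eqF//; lra.
    by move: k_neq0; move: (k%:R) => y y0 y1; field; rewrite y0 y1.
  by apply: cvgMl_tmp; apply: cvgB; [exact: cvg_cst|exact: cvx].
pose m n := \int[P]_x U n x 0 j.
have m_step n : m n.+1 = m n + \int[P]_x incr n (U n x).
  rewrite /m (urn_expectation_step urnU n (fun v => v 0 j)).
  rewrite -RintegralD//; last 2 first.
  - exact: (urn_integrable urnU n (fun v => v 0 j)).
  - exact: (urn_integrable urnU n (incr n)).
  apply: eq_Rintegral => x _.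
  have Un := urn_stateU M_stoch U0_prob urnU n x.
  under eq_bigr do rewrite !mxE mulrDr.
  by rewrite big_split /= -mulr_suml (sum_draw_prob k_ge2 theta_ge1 Un) mul1r.
have m_a n : m n = n.+1%:R * a n.
  rewrite /a RintegralZr//; last exact: (urn_integrable urnU n (fun v => v 0 j)).
  by rewrite mulrC divfK ?pnatr_eq0.
have := cesaro cv_incr.
have -> : arithmetic_mean (fun n => \int[P]_x incr n (U n x)) =
    (fun n => a n.+1 + (a n.+1 - m 0%N) * harmonic n).
  apply/funext => n; rewrite /arithmetic_mean /= /series /=.
  have -> : \sum_(0 <= i < n.+1) \int[P]_x incr i (U i x) = m n.+1 - m 0%N.
    by rewrite -telescope_sumr//; apply: eq_bigr => i _; rewrite m_step addrC addKr.
  rewrite m_a -[n.+2%:R]natr1; have : n.+1%:R != 0 :> R by rewrite pnatr_eq0.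
  by move: n.+1%:R => x x0; field.
move=> cv_mean.
have cv_a1 : a n.+1 @[n --> \oo] --> (k%:R^-1 : R) by rewrite (cvg_shiftS a).
have : a n.+1 + (a n.+1 - m 0%N) * harmonic n @[n --> \oo] -->
    (k%:R^-1 + (k%:R^-1 - m 0%N) * 0 : R).
  apply: cvgD => //; apply: cvgM; last exact: cvg_harmonic.
  by apply: cvgB => //; exact: cvg_cst.
move=> /(cvg_unique _ cv_mean); rewrite mulr0 addr0 -mulr_sumr => E.
by apply: (mulfI (invr_neq0 k_neq0)); rewrite mulr1 E.
Qed.

Lemma doubly_stochastic_uniform_limit :
  irreducible (hat_mx theta M) -> doubly_stochastic M ->
  {ae P, forall x, (fun n : nat => n.+1%:R^-1 *: U n x) @ \oo
       --> (const_mx k%:R^-1 : 'rV[R]_k)}.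
Proof.
move=> irr Mds.
have [g g0 gap] := irreducible_drift_gap k_ge2 theta_ge1 Mds irr.
have := sq_dist_cvg0 k_ge2 theta_ge1 M_stoch U0_prob urnU g0 Mds gap.
apply: filterS => x cv0; apply/cvg_ballP => e e0.
have : \forall n \near \oo, sq_dist n (U n x) < e ^+ 2.
  by apply: (cvgr_lt 0) => //; rewrite exprn_gt0.
apply: filterS => n close; split=> // i j; rewrite (ord1 i) !mxE.
rewrite /ball /= distrC -(ltr_pXn2r (n := 2))// ?nnegrE// ?(ltW e0)//.
rewrite real_normK ?num_real//; apply: le_lt_trans close.
rewrite /sq_dist (bigD1 j)//= mulrC lerDl.
by apply: sumr_ge0 => l _; exact: sqr_ge0.
Qed.

End uniform_limit.

Theorem mainTheorem2 (R : realType) (d : measure_display)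
    (T : measurableType d) (P : probability T R)
    (k : nat) (hk : (2 <= k)%N) (theta : R) (htheta : 1 <= theta)
    (M : 'M[R]_k) (hM : stochastic M)
    (U0 : 'rV[R]_k) (hU0 : prob_vector U0)
    (U : nat -> T -> 'rV[R]_k) (Z : nat -> T -> 'I_k)
    (hU : urn_scheme P theta M U0 U Z)
    (hirr : irreducible (hat_mx theta M)) :
  {ae P, forall x,
     (fun n : nat => n.+1%:R^-1 *: U n x) @ \oo
       --> (const_mx k%:R^-1 : 'rV[R]_k)}
  <-> doubly_stochastic M.
Proof.
split; first exact: (uniform_limit_doubly_stochastic hk htheta hM hU0 hU).
exact: (doubly_stochastic_uniform_limit hk htheta hM hU0 hU hirr).
Qed.
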